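(* Let $G=(V,E)$ be a connected graph and let $B$ be any metric basis of $G$. Then $B$ is a simultaneous metric generator for any (nonempty) family $\mathcal{H}\subseteq\mathcal{G}_B$ of connected graphs. Moreover, if $G\in\mathcal{H}$, then $$\operatorname{Sd}(\mathcal{H})=\dim(G).$$
   Context: All graphs are finite and simple. For a connected graph $G=(V,E)$, $d_G(x,y)$ denotes the length of a shortest path between $x$ and $y$ in $G$, and $D(G)$ is the diameter of $G$. A vertex $v$ resolves two vertices $x,y$ if $d_G(v,x)\ne d_G(v,y)$. A set $S\subseteq V$ is a metric generator for $G$ if every pair of distinct vertices of $G$ is resolved by some element of $S$; a metric basis of $G$ is a metric generator of minimum cardinality, and this cardinality is the metric dimension $\dim(G)$. For a finite family $\mathcal{H}$ of connected graphs on a common vertex set $V$, a simultaneous metric generator for $\mathcal{H}$ is a set $S\subseteq V$ that is a metric generator for every graph in $\mathcal{H}$; the simultaneous metric dimension $\operatorname{Sd}(\mathcal{H})$ is the minimum cardinality of a simultaneous metric generator for $\mathcal{H}$. $N_G(v)$ denotes the open neighborhood of $v$ in $G$. For $X\subseteq V$, $\mathcal{S}(X)$ denotes the set of permutations $f$ of $V$ with $f(x)=x$ for every $x\in X$, and $f(Y)=\{f(y): y\in Y\}$ for $Y\subseteq V$. For a metric basis $B$ of $G$ and $r\in\{0,1,\dots,D(G)\}$, let $\mathbf{B}_r(B)=\bigcup_{x\in B}\{y\in V: d_G(x,y)\le r\}$. For a connected non-complete graph $G=(V,E)$ with metric basis $B$ and $f\in\mathcal{S}(B)$, the family $\mathcal{G}_f$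 consists of all graphs $G'=(V,E')$ such that $N_{G'}(f(v))=f(N_G(v))$ for every $v\in\mathbf{B}_{D(G)-2}(B)$. If $G$ is complete, $\mathcal{G}_f=\{G\}$. Finally, $\mathcal{G}_B=\bigcup_{f\in\mathcal{S}(B)}\mathcal{G}_f$. *)

(* Defs.v *)
From HB Require Import structures.
From mathcomp Require Import all_boot all_fingroup.

Set Implicit Arguments.
Unset Strict Implicit.
Unset Printing Implicit Defensive.

(* The simple graphs on V form a finType, so that a finite family of graphs on
   V is a {set graph V}. *)
Record graph (V : finType) := Graph {
  edges : {set {set V}};
  edges_card2 : [forall e in edges, #|e| == 2]
}.

HB.instance Definition _ (V : finType) := [isSub for @edges V].
HB.instance Definition _ (V : finType) := [Finite of graph V by <:].

Section MetricDimension.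
Variable V : finType.
Implicit Types (G : graph V) (S B X : {set V}) (H : {set graph V}).

Definition adj G : rel V := fun x y => [set x; y] \in edges G.

Definition nbhd G (v : V) : {set V} := [set w | adj G v w].

Definition connected G : bool := [forall x, forall y, connect (adj G) x y].

Definition complete G : bool := [forall x, forall y, (x != y) ==> adj G x y].

Definition has_walk G (x y : V) (n : nat) : bool :=
  [exists p : n.-tuple V, path (adj G) x p && (last x p == y)].

(* The least n such that some walk from x to y has length n; only n < #|V| need
   be tried. The junk value #|V| is taken when y is not reachable from x. *)
Definition dist G (x y : V) : nat := find (has_walk G x y) (iota 0 #|V|).

Definition diam G : nat := \max_(x : V) \max_(y : V) dist G x y.

Definition resolves G (v x y : V) : bool := dist G v x != dist G v y.

Definition metric_generator G S : bool :=
  [forall x, forall y, (x != y) ==> [exists v in S, resolves G v x y]].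

Definition sim_metric_generator H S : bool :=
  [forall G in H, metric_generator G S].

(* In both minima below the default setT is itself admissible, since x resolves
   x from every other vertex. *)
Definition dim G : nat :=
  #|[arg min_(S < [set: V] | metric_generator G S) #|S|]|.

Definition Sd H : nat :=
  #|[arg min_(S < [set: V] | sim_metric_generator H S) #|S|]|.

Definition metric_basis G B : bool := metric_generator G B && (#|B| == dim G).

Definition perms_fixing X : {set {perm V}} :=
  [set f : {perm V} | [forall x in X, f x == x]].

Definition balls G B (r : nat) : {set V} :=
  \bigcup_(x in B) [set y | dist G x y <= r].

(* diam G - 2 is truncated, which is harmless: a connected non-complete graph
   has diameter at least 2. *)
Definition family_perm G B (f : {perm V}) : {set graph V} :=
  if complete G then [set G]
  else [set G' | [forall v in balls G B (diam G - 2),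
                    nbhd G' (f v) == f @: nbhd G v]].

Definition family_basis G B : {set graph V} :=
  \bigcup_(f in perms_fixing B) family_perm G B f.

Lemma has_walkP G x y n :
  reflect (exists p, [/\ path (adj G) x p, last x p = y & size p = n])
          (has_walk G x y n).
Proof.
apply: (iffP existsP) => [[p /andP[ep /eqP lp]]|[p [ep lp sp]]].
  by exists p; rewrite size_tuple.
have sp' : size p == n by apply/eqP.
by exists (Tuple sp') => /=; rewrite ep lp eqxx.
Qed.

Lemma dist_le G x p : path (adj G) x p -> dist G x (last x p) <= size p.
Proof.
move=> ep; rewrite /dist leqNgt; apply/negP => lt_d.
have lt_n : size p < #|V|.
  by apply: leq_trans lt_d _; apply: leq_trans (find_size _ _) _; rewrite size_iota.
have := before_find 0 lt_d; rewrite nth_iota // add0n.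
by move/negbT/negP=> nw; apply: nw; apply/has_walkP; exists p.
Qed.

Lemma dist_walk G x y : connect (adj G) x y -> has_walk G x y (dist G x y).
Proof.
case/connectP=> p0 ep0 ->; case/shortenP: ep0 => p ep up _.
have lt_p : size p < #|V| by rewrite -[(size p).+1]/(size (x :: p)) -(card_uniqP up) max_card.
have lt_d : dist G x (last x p) < #|V| by apply: leq_ltn_trans (dist_le ep) lt_p.
have hs : has (has_walk G x (last x p)) (iota 0 #|V|) by rewrite has_find size_iota.
by have := nth_find 0 hs; rewrite nth_iota.
Qed.

Lemma metric_generatorT G : metric_generator G [set: V].
Proof.
apply/forallP=> x; apply/forallP=> y; apply/implyP=> nxy.
apply/existsP; exists x; rewrite inE /resolves /=.
have d0 : dist G x x = 0.
  by apply/eqP; rewrite -leqn0 (@dist_le G x [::]).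
rewrite d0 eq_sym; apply/negP => /eqP dy0.
have V0 : 0 < #|V| by apply/card_gt0P; exists x.
have hs : has (has_walk G x y) (iota 0 #|V|) by rewrite has_find size_iota -/(dist G x y) dy0.
have := nth_find 0 hs; rewrite -/(dist G x y) dy0 nth_iota // => /has_walkP[p [_ lp /size0nil p0]].
by move: nxy; rewrite -lp p0 eqxx.
Qed.

End MetricDimension.

(* Main.v *)
Require Import Defs.
From mathcomp Require Import all_boot all_fingroup.

(** Suppose that [G] is not complete; otherwise its family is just [G] itself.
    Let [G'] be a connected graph in the family defined by the permutation [f],
    and let [D] be the diameter of [G]. Since [f] carries the [G]-neighborhood
    of every vertex within distance [D - 2] of the basis [B] onto a
    [G']-neighborhood, breadth-first search from a vertex [x] of [B] runs in the
    same way in both graphs for [D - 1] rounds: for [n <= D - 1] the ball of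
    radius [n] around [x] in [G'] is the image under [f] of the ball of radius
    [n] in [G] ([family_perm_ball]).

    This is enough to resolve. If [x] in [B] resolves [u] and [v] in [G], the
    smaller of the two distances from [x] is at most [D - 1], so the ball with
    that radius separates [u] from [v]; its image is a ball around [x] in [G']
    that separates [f u] from [f v]. As [f] is onto, [B] generates [G']. Hence
    [B] is a simultaneous metric generator; when [G] belongs to the family, no
    smaller set can be one, for it would have to be a metric generator
    of [G]. *)

Section Balls.
Context {V : finType}.
Implicit Types (G : graph V) (B S : {set V}) (H : {set graph V}).

(** Connectedness excludes the junk value [#|V|] of [dist], which would satisfy
    [dist G x y <= n] for large [n] although no walk exists. *)
Lemma dist_leP {G x y n} : connected G ->
  reflect (exists p, [/\ path (adj G) x p, last x p = y & size p <= n])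
          (dist G x y <= n).
Proof.
move=> /forallP/(_ x)/forallP/(_ y) cxy; apply: (iffP idP) => [le_n|].
  by have /has_walkP[p [ep lp sp]] := dist_walk cxy; exists p; rewrite sp.
by case=> p [ep <- sp]; apply: leq_trans (dist_le ep) sp.
Qed.

Lemma dist_le0 G x y : connected G -> (dist G x y <= 0) = (x == y).
Proof.
move=> cG; apply/(dist_leP cG)/eqP => [[p [_ lp]]|->].
  by rewrite leqn0 => /nilP p0; rewrite p0 in lp.
by exists [::].
Qed.

(** One round of breadth-first search: this turns a ball into a function of the
    previous one, so that balls in two graphs can be compared by induction. *)
Lemma dist_leS G x y n : connected G ->
  (dist G x y <= n.+1) =
  (dist G x y <= n) || [exists z, (dist G x z <= n) && adj G z y].
Proof.
move=> cG; apply/idP/orP => [|[/leqW //|/existsP[z /andP[]]]].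
  case/(dist_leP cG)=> p; case/lastP: p => [[_ <- _]|p z].
    by left; apply/(dist_leP cG); exists [::].
  rewrite rcons_path last_rcons size_rcons ltnS => -[/andP[ep az] <- sp].
  right; apply/existsP; exists (last x p); rewrite az andbT.
  by apply: leq_trans (dist_le ep) sp.
case/(dist_leP cG)=> p [ep lp sp] az.
apply/(dist_leP cG); exists (rcons p y).
by rewrite rcons_path ep lp az last_rcons size_rcons ltnS.
Qed.

Lemma dist_le_diam G x y : dist G x y <= diam G.
Proof. exact: leq_trans (leq_bigmax y) (leq_bigmax x). Qed.

Lemma metric_generatorP {G S} :
  reflect (forall x y, x != y -> exists2 v, v \in S & dist G v x != dist G v y)
          (metric_generator G S).
Proof.
apply: (iffP forallP) => [gS x y|gS x].
  by move/forallP: (gS x) => /(_ y)/implyP h /h /exists_inP.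
by apply/forallP=> y; apply/implyP=> /gS/exists_inP.
Qed.

(** The vertices expanded in the rounds that build a ball of radius [r.+1] lie
    within distance [r] of [x], where [f] respects neighborhoods. *)
Lemma nbhd_image_ball G G' B (f : {perm V}) r x n v :
    connected G -> connected G' -> x \in B -> f x = x ->
    {in balls G B r, forall w, nbhd G' (f w) = f @: nbhd G w} ->
  n <= r.+1 -> (dist G' x (f v) <= n) = (dist G x v <= n).
Proof.
move=> cG cG' Bx fx nbhdE; elim: n v => [|n IHn] v le_n.
  by rewrite !dist_le0 // -{1}fx (inj_eq perm_inj).
have {}IHn w := IHn w (ltnW le_n).
have adjE z : dist G x z <= n -> adj G' (f z) (f v) = adj G z v.
  move=> le_z; have /nbhdE/setP/(_ (f v)) : z \in balls G B r.
    by apply/bigcupP; exists x; rewrite // inE (leq_trans le_z).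
  by rewrite mem_imset ?inE //; apply: perm_inj.
rewrite !dist_leS // IHn; congr (_ || _).
apply/existsP/existsP => -[z /andP[le_z az]].
  rewrite -(permKV f z) IHn in le_z az *.
  by exists (f^-1%g z); rewrite le_z -adjE.
by exists (f z); rewrite IHn le_z adjE.
Qed.

(** A search with [r.+1] correct rounds, for [r = diam G - 2], covers every
    radius below the diameter because [diam G <= (diam G - 2).+2], also when the
    subtraction truncates. *)
Lemma family_perm_ball G G' B (f : {perm V}) x n v :
    connected G -> connected G' -> ~~ complete G ->
    f \in perms_fixing B -> G' \in family_perm G B f -> x \in B ->
  n < diam G -> (dist G' x (f v) <= n) = (dist G x v <= n).
Proof.
move=> cG cG' /negPf ncG; rewrite /family_perm ncG !inE.
move=> /forall_inP fixB /forall_inP nbhdE Bx lt_n.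
apply: (@nbhd_image_ball _ _ _ _ (diam G - 2) _ _ _ cG cG' Bx).
- exact/eqP/fixB.
- by move=> w /nbhdE/eqP.
by rewrite -ltnS (leq_trans lt_n) // -[_.+2]addn2 addnC -leq_subLR.
Qed.

Lemma family_basis_generator G G' B :
    connected G -> connected G' -> metric_generator G B ->
    G' \in family_basis G B ->
  metric_generator G' B.
Proof.
move=> cG cG' gB /bigcupP[f fixB G'f].
have [compG|ncG] := boolP (complete G).
  by move: G'f; rewrite /family_perm compG inE => /eqP->.
have ballE x n v : x \in B -> n < diam G ->
    (dist G' x (f v) <= n) = (dist G x v <= n).
  by move=> Bx; apply: family_perm_ball fixB G'f Bx.
apply/metric_generatorP=> u' v'; rewrite -(permKV f u') -(permKV f v').
move: (f^-1%g u') (f^-1%g v') => u v; rewrite (inj_eq perm_inj).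
case/(metric_generatorP gB) => x Bx ne_uv; exists x => //.
wlog lt_uv : u v ne_uv / dist G x u < dist G x v.
  move=> IH; move: (ne_uv); rewrite neq_ltn => /orP[]; first exact: IH.
  by rewrite eq_sym; apply: IH; rewrite eq_sym.
have lt_D : dist G x u < diam G by apply: leq_trans lt_uv (dist_le_diam G x v).
rewrite neq_ltn; apply/orP; left.
apply: (@leq_ltn_trans (dist G x u)); first by rewrite ballE.
by rewrite ltnNge ballE // -ltnNge.
Qed.

Lemma dim_min G S : metric_generator G S -> dim G <= #|S|.
Proof.
by rewrite /dim; case: arg_minnP => [|T _]; [apply: metric_generatorT | apply].
Qed.

Lemma sim_metric_generatorT H : sim_metric_generator H [set: V].
Proof. by apply/forall_inP=> G _; apply: metric_generatorT. Qed.

Lemma Sd_min H S : sim_metric_generator H S -> Sd H <= #|S|.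
Proof.
rewrite /Sd; case: arg_minnP => [|T _]; last by apply.
exact: sim_metric_generatorT.
Qed.

Lemma dim_le_Sd G H : G \in H -> dim G <= Sd H.
Proof.
rewrite /Sd; case: arg_minnP => [|T /forall_inP gT _ /gT/dim_min //].
exact: sim_metric_generatorT.
Qed.

End Balls.

Theorem theorem4p4 (V : finType) (G : graph V) (B : {set V})
    (hG : connected G) (hB : metric_basis G B)
    (H : {set graph V}) (H0 : H != set0)
    (HB : H \subset family_basis G B)
    (Hconn : forall G', G' \in H -> connected G') :
  sim_metric_generator H B /\ (G \in H -> Sd H = dim G).
Proof.
have /andP[gB /eqP cardB] := hB.
have gHB : sim_metric_generator H B.
  apply/forall_inP=> G' HG'.
  exact: family_basis_generator (Hconn _ HG') gB (subsetP HB _ HG').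
split=> // HG; apply/eqP.
by rewrite eqn_leq dim_le_Sd // -cardB Sd_min.
Qed.
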